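(* Let $n$ be a positive integer. If there is a ring $R$ of characteristic zero whose group of units is isomorphic to $\mathrm{Hol}(\mathbf{Z}_n)$, then $n = 2m$ for some odd integer $m$.
   Context: Rings are associative with identity, not necessarily commutative or finite. $\mathbf{Z}_n$ is the cyclic group of integers modulo $n$, and $\mathrm{Hol}(\mathbf{Z}_n) = \mathbf{Z}_n \rtimes \mathrm{Aut}(\mathbf{Z}_n) = \mathbf{Z}_n \rtimes \mathbf{Z}_n^\times$ is its holomorph, i.e. the group of maps $x \mapsto ax+b$ on $\mathbf{Z}_n$ with $a \in \mathbf{Z}_n^\times$, $b\in \mathbf{Z}_n$. *)

(* Defs.v *)
From HB Require Import structures.
From mathcomp Require Import all_boot all_order all_fingroup all_algebra.

Set Implicit Arguments.
Unset Strict Implicit.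
Unset Printing Implicit Defensive.

Import GRing.Theory.
Local Open Scope ring_scope.

(* [pchar R] =i pred0 would be too weak: it only says that no prime vanishes  *)
(* in R, which also holds in Z/4Z.                                            *)
Definition char_zero (R : nzRingType) : Prop :=
  forall k : nat, k%:R = 0 :> R -> k = 0%N.

(* The group of units of an arbitrary ring. An element is a pair (x, y) with  *)
(* y the two-sided inverse of x; as y is determined by x, such pairs are the  *)
(* same as units. Carrying y along avoids requiring a unitRingType (decidable *)
(* invertibility); {unit R} is available for finite R only.                   *)
Definition is_inv_pair (R : nzRingType) : pred (R * R) :=
  fun p => (p.1 * p.2 == 1) && (p.2 * p.1 == 1).

Record unit_group (R : nzRingType) : Type :=
  UnitGroup { unit_pair :> R * R; unit_pairP : is_inv_pair unit_pair }.

HB.instance Definition _ (R : nzRingType) :=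
  [isSub for @unit_pair R].
HB.instance Definition _ (R : nzRingType) :=
  [Choice of unit_group R by <:].

Section UnitGroupOps.

Variable R : nzRingType.
Implicit Types u v : unit_group R.

Fact unit_group_one_subproof : is_inv_pair ((1, 1) : R * R).
Proof. by rewrite /is_inv_pair /= mulr1 eqxx. Qed.

Fact unit_group_mul_subproof u v : is_inv_pair (u.1 * v.1, v.2 * u.2).
Proof.
case: u v => [[x x'] /andP[/= /eqP xx' /eqP x'x]].
case=> [[y y'] /andP[/= /eqP yy' /eqP y'y]].
apply/andP; split=> /=; apply/eqP.
  by rewrite mulrA -(mulrA x) yy' mulr1.
by rewrite mulrA -(mulrA y') x'x mulr1.
Qed.

Fact unit_group_inv_subproof u : is_inv_pair (u.2, u.1).
Proof. by case: u => -[x y] /andP[/= xy yx]; apply/andP. Qed.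

Definition unit_group_one := UnitGroup unit_group_one_subproof.
Definition unit_group_mul u v := UnitGroup (unit_group_mul_subproof u v).
Definition unit_group_inv u := UnitGroup (unit_group_inv_subproof u).

Fact unit_group_mulA : associative unit_group_mul.
Proof. by move=> u v w; apply: val_inj; rewrite /= !mulrA. Qed.

Fact unit_group_mul1 : left_id unit_group_one unit_group_mul.
Proof. by case=> -[x y] xy; apply: val_inj; rewrite /= mul1r mulr1. Qed.

Fact unit_group_mulr1 : right_id unit_group_one unit_group_mul.
Proof. by case=> -[x y] xy; apply: val_inj; rewrite /= mul1r mulr1. Qed.

Fact unit_group_mulV :
  left_inverse unit_group_one unit_group_inv unit_group_mul.
Proof.
by case=> -[x y] xy; apply: val_inj; case/andP: (xy) => /= _ /eqP ->.
Qed.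

Fact unit_group_mulrV :
  right_inverse unit_group_one unit_group_inv unit_group_mul.
Proof.
by case=> -[x y] xy; apply: val_inj; case/andP: (xy) => /= /eqP ->.
Qed.

End UnitGroupOps.

HB.instance Definition _ (R : nzRingType) :=
  isGroup.Build (unit_group R) (@unit_group_mulA R) (@unit_group_mul1 R)
    (@unit_group_mulr1 R) (@unit_group_mulV R) (@unit_group_mulrV R).

(* Isomorphism of possibly infinite groups: \isog only covers finite groups.  *)
Definition group_iso (G H : groupType) : Prop :=
  exists f : {multiplicative G -> H}, bijective f.

(* The holomorph of G is G ><| Aut G, with Aut G acting naturally on G.       *)
Definition Hol (gT : finGroupType) (G : {group gT}) : finGroupType :=
  sdprod_by (aut_groupAction G).

(* Zp n is the additive group Z/nZ for every n > 0, including n = 1 where it  *)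
(* is trivial; the ring type 'Z_n would wrongly give Z/2Z for n = 1.          *)
Definition HolZ (n : nat) : finGroupType := Hol (Zp_group n).

(* Main.v *)
Require Import Defs.
From HB Require Import structures.
From mathcomp Require Import all_boot all_order all_fingroup all_algebra.
From mathcomp Require Import cyclic.

(** The central unit -1 corresponds to a central involution of Hol(Z_n), which
    must be a translation x; hence n is even. If 4 | n, then x = y^2 for some
    translation y, and inversion on Z_n gives an involution c inverting y. In R
    this yields i, c with i^2 = -1, c^2 = 1 and ic = -ci, so N = i(1 + c) squares
    to zero. The unit 1 + N would then have finite order although
    (1 + N)^k = 1 + kN and kN <> 0 for k > 0. *)

Set Implicit Arguments.
Unset Strict Implicit.
Unset Printing Implicit Defensive.

Import GRing.Theory.

Section SplitQuaternions.

Local Open Scope ring_scope.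

Lemma expr1D_sqr0 (R : nzRingType) (x : R) k :
  x * x = 0 -> (1 + x) ^+ k = 1 + x *+ k.
Proof.
move=> xx0; elim: k => [|k IHk]; first by rewrite expr0 addr0.
rewrite exprS IHk mulrDl mul1r mulrDr mulr1.
by rewrite mulrnAr xx0 mul0rn addr0 mulrSr addrA addrAC.
Qed.

Variables (R : nzRingType) (i c : R).
Hypotheses (ii : i * i = -1) (cc : c * c = 1) (ic : i * c = - (c * i)).

Lemma split_quaternion_anticomm : (1 + c) * i = i * (1 - c).
Proof. by rewrite mulrDl mulrBr mul1r mulr1 ic opprK. Qed.

(** Moving the inner i leftwards past 1 + c turns it into 1 - c, and (1 - c)(1 + c) = 1 - c^2 =
    0. *)
Lemma split_quaternion_nilp : (i * (1 + c)) * (i * (1 + c)) = 0.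
Proof.
rewrite mulrA -(mulrA i) split_quaternion_anticomm -!mulrA.
suff ->: (1 - c) * (1 + c) = 0 by rewrite !mulr0.
by rewrite mulrBl mul1r mulrDr mulr1 cc [X in _ - X]addrC subrr.
Qed.

(** As i is invertible, k(1 + c) = 0; moving i across gives k(1 - c) = 0 as well. The sum is 2k = 0
    in R. Merely knowing N <> 0 would not do, since R may have additive torsion. *)
Lemma split_quaternion_nilp_torsion k :
  char_zero R -> (i * (1 + c)) *+ k = 0 -> k = 0%N.
Proof.
move=> charR Nk0.
have i_inj x : i * x = 0 -> x = 0.
  move/(congr1 ( *%R i)); rewrite mulrA ii mulN1r mulr0 => /eqP.
  by rewrite oppr_eq0 => /eqP.
have ck : (1 + c) *+ k = 0 by apply: i_inj; rewrite mulrnAr.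
have c'k : (1 - c) *+ k = 0.
  by apply: i_inj; rewrite mulrnAr -split_quaternion_anticomm -mulrnAl ck mul0r.
have : (2 * k)%N%:R = 0 :> R.
  rewrite mulrnA -[RHS]addr0 -{1}ck -c'k -mulrnDl; congr (_ *+ k).
  by rewrite addrACA subrr addr0.
by move/charR/eqP; rewrite muln_eq0 => /eqP.
Qed.

End SplitQuaternions.

Local Open Scope group_scope.

Lemma unit_group_eqP (R : nzRingType) (u v : unit_group R) : u.1 = v.1 -> u = v.
Proof.
case: u v => -[x x'] xP [[y y'] yP] /= xy; apply: val_inj => /=; rewrite -xy.
case/andP: xP yP => /= _ /eqP x'x /andP[/= /eqP yy' _].
by congr (_, _); rewrite -[x']mulr1 -yy' mulrA -xy x'x mul1r.
Qed.

Lemma unit_groupX (R : nzRingType) (u : unit_group R) k :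
  (u ^+ k).1 = (u.1 ^+ k)%R.
Proof. by elim: k => [|k IHk] //; rewrite expgS exprS -IHk. Qed.

Fact unit_group_opp1_subproof (R : nzRingType) : is_inv_pair ((-1, -1) : R * R)%R.
Proof. by rewrite /is_inv_pair /= mulrNN mulr1 eqxx. Qed.

Definition unit_group_opp1 (R : nzRingType) :=
  UnitGroup (unit_group_opp1_subproof R).

Lemma unit_group_opp1_central (R : nzRingType) (u : unit_group R) :
  commute (unit_group_opp1 R) u.
Proof. by apply: unit_group_eqP; rewrite /= mulN1r mulrN1. Qed.

Lemma unit_group_opp1_sqr (R : nzRingType) :
  unit_group_opp1 R * unit_group_opp1 R = 1.
Proof. by apply: unit_group_eqP; rewrite /= mulrNN mulr1. Qed.

Lemma unit_group_opp1_neq1 (R : nzRingType) :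
  char_zero R -> unit_group_opp1 R <> 1.
Proof.
move=> charR /(congr1 (fun u : unit_group R => u.1)) /= N11.
by have /charR : (2%:R = 0 :> R)%R by rewrite mulr2n -{1}N11 addNr.
Qed.

Lemma unit_group_no_split_quaternion (R : nzRingType) (u v : unit_group R) :
  char_zero R -> (forall w : unit_group R, exists2 k, (0 < k)%N & w ^+ k = 1) ->
  u * u = unit_group_opp1 R -> v * v = 1 -> u * v <> v * u^-1.
Proof.
move=> charR fin uu vv uv; pose val1 (w : unit_group R) := w.1.
have ii := congr1 val1 uu; have cc := congr1 val1 vv.
(* Since u^2 = -1, the inverse of u is -u, so the relation uv = vu^-1 becomes ic = -ci in R. *)
have Vu : u^-1 = unit_group_opp1 R * u.
  by rewrite -uu; apply: (mulgI u); rewrite mulgV !mulgA uu -mulgA uu unit_group_opp1_sqr.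
have ic : (u.1 * v.1 = - (v.1 * u.1))%R.
  by have := congr1 val1 uv; rewrite Vu /val1 /= mulN1r mulrN.
have NN := split_quaternion_nilp cc ic.
set N := (u.1 * (1 + v.1))%R in NN.
(* The inverse of 1 + N is 1 - N because N^2 = 0. *)
have wP : is_inv_pair (1 + N, 1 - N)%R.
  apply/andP; split; apply/eqP=> /=.
    by rewrite mulrDl mul1r mulrBr mulr1 NN subr0 subrK.
  by rewrite mulrBl mul1r mulrDr mulr1 NN addr0 addrK.
have [k k_gt0 /(congr1 val1)] := fin (UnitGroup wP).
rewrite /val1 unit_groupX /= expr1D_sqr0 // => /eqP; rewrite -subr_eq0 addrC addKr.
by move/eqP/(split_quaternion_nilp_torsion ii ic charR) => k0; rewrite k0 in k_gt0.
Qed.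

Section Holomorph.

Variables (gT : finGroupType) (G : {group gT}).

Lemma Hol_sdpair_act x a : x \in G -> a \in Aut G ->
  sdpair1 [Aut G] (a x) = sdpair1 [Aut G] x ^ sdpair2 [Aut G] a.
Proof. by move=> Gx Aa; rewrite -sdpair_act. Qed.

Hypothesis abG : abelian G.

(** Write z = a x with a an automorphism and x a translation. Conjugation by z sends a translation y
    to a(y)^x, which is a(y) since G is abelian; centrality of z then forces a(y) = y. *)
Lemma Hol_central_translation (z : Hol G) :
  (forall w, commute z w) -> exists2 x, x \in G & z = sdpair1 [Aut G] x.
Proof.
case: z => -[a x] /= axP; have [/= Aa Gx] := setXP axP => zC.
have zE := sdpairE (SdPair _ axP); rewrite zE /= in zC *.
exists x => //; suff a1 : a = 1 by rewrite a1 morph1 mul1g.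
apply/permP=> y; rewrite perm1.
(* Elements of [Aut G] are permutations of all of [gT] that fix every point outside G. *)
have [Gy|G'y] := boolP (y \in G); last exact: (out_Aut Aa).
apply: (injmP (injm_sdpair1 [Aut G])) => //; first exact: Aut_closed.
rewrite /= Hol_sdpair_act //.
have fix_conj (u v : Hol G) : commute v u -> u ^ v = u.
  by move=> vu; apply/conjg_fixP/commgP/commute_sym.
transitivity ((sdpair1 [Aut G] y ^ sdpair2 [Aut G] a) ^ sdpair1 [Aut G] x).
  rewrite -Hol_sdpair_act // fix_conj // /commute -!morphM ?Aut_closed //.
  by rewrite (centsP abG) ?Aut_closed.
by rewrite -conjgM fix_conj //; apply: zC.
Qed.

(** The witness c is the automorphism y |-> y^-1, a morphism because G is abelian. *)
Lemma Hol_inversion :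
  exists2 c : Hol G, c * c = 1 &
    forall y, y \in G ->
      sdpair1 [Aut G] y * c = c * (sdpair1 [Aut G] y)^-1.
Proof.
have invM : {in G &, {morph invg : x y / x * y}}.
  by move=> x y Gx Gy; rewrite invMg (centsP abG) ?groupV.
pose f := Morphism invM.
have injf : 'injm f by apply/injmP=> x y _ _ /invg_inj.
have imf : f @* G = G.
  apply/eqP; rewrite eqEcard card_injm // leqnn andbT.
  by apply/subsetP=> _ /morphimP[x _ Gx ->]; rewrite groupV.
pose a := aut injf imf; have Aa : a \in Aut G := Aut_aut injf imf.
exists (sdpair2 [Aut G] a).
  rewrite -morphM // (_ : a * a = 1) ?morph1 //; apply/permP=> x; rewrite permM perm1.
  have [Gx|G'x] := boolP (x \in G); last by rewrite !(out_Aut Aa).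
  by rewrite /a !autE ?groupV //= invgK.
move=> y Gy; rewrite conjgC -Hol_sdpair_act // -morphV //.
by congr (_ * sdpair1 _ _); apply: autE.
Qed.

End Holomorph.

(** With t a generator and x = t^k, the equation x^2 = 1 says that the order of t divides 2k. Hence
    4 divides 2k, so k = 2j and y = t^j works. *)
Lemma cyclic_sqrt (gT : finGroupType) (G : {group gT}) x :
  cyclic G -> 4 %| #|G| -> x \in G -> x * x = 1 -> exists2 y, y \in G & y * y = x.
Proof.
case/cyclicP=> t ->; rewrite -orderE => dv4 /cycleP[k ->] /eqP.
rewrite -expgD addnn -muln2 -order_dvdn => /(dvdn_trans dv4).
rewrite -[4]/(2 * 2)%N dvdn_pmul2r // => /dvdnP[j ->].
by exists (t ^+ j); rewrite ?mem_cycle // -expgD addnn muln2.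
Qed.

Lemma cyclic_Zp n : cyclic (Zp n).
Proof.
by rewrite /Zp; case: ifP => _; rewrite ?cyclic1 // Zp_cycle cycle_cyclic.
Qed.

Theorem mainTheorem4 (n : nat) (n_gt0 : (0 < n)%N) (R : nzRingType)
    (charR : char_zero R) (isoR : group_iso (unit_group R) (HolZ n)) :
  exists m : nat, odd m /\ n = (2 * m)%N.
Proof.
case: isoR => f [g fK gK].
have cG := cyclic_Zp n; have abG := cyclic_abelian cG; have oG := card_Zp n_gt0.
have gM : {morph g : x y / x * y} := can2_gmulfM fK gK.
have g1 : g 1 = 1 by apply: (mulgI (g 1)); rewrite -gM !mulg1.
(* Every w in the holomorph is f (g w), so centrality of -1 passes through f. *)
have [x Gx fN1] : exists2 x, x \in Zp n & f (unit_group_opp1 R) = sdpair1 [Aut (Zp n)] x.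
  apply: Hol_central_translation => // w; rewrite -[w]gK.
  exact/gmulf_commute/unit_group_opp1_central.
have gx : g (sdpair1 [Aut (Zp n)] x) = unit_group_opp1 R by rewrite -fN1 fK.
have x2 : x * x = 1.
  apply: (injmP (injm_sdpair1 [Aut (Zp n)])); rewrite ?groupM //.
  rewrite !morphM //= morph1; apply: (can_inj gK).
  by rewrite gM gx g1 unit_group_opp1_sqr.
have x1 : x != 1.
  apply/eqP=> x1; apply: (unit_group_opp1_neq1 charR).
  by rewrite -gx x1 morph1 g1.
have ox : #[x] = 2 by apply: nt_prime_order.
have /dvdnP[m def_n] : 2 %| n by rewrite -oG -ox order_dvdG.
exists m; split; last by rewrite mulnC.
apply/negPn/negP => m_even.
have dv4 : 4 %| #|Zp n| by rewrite oG def_n -[4]/(2 * 2)%N dvdn_pmul2r // dvdn2.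
have [y Gy yy] := cyclic_sqrt cG dv4 Gx x2.
have [c cc yc] := Hol_inversion abG.
have /(congr1 g) := yc y Gy; rewrite !gM.
have -> : g (sdpair1 [Aut (Zp n)] y)^-1 = (g (sdpair1 [Aut (Zp n)] y))^-1.
  by apply: (mulgI (g (sdpair1 [Aut (Zp n)] y))); rewrite mulgV -gM mulgV.
(* Here u = g(y) and v = g(c), with y^2 = x mapped by g to -1. *)
apply: unit_group_no_split_quaternion => //.
(* Every unit w has finite order, since f w lies in a finite group. *)
- move=> w; exists #[f w]; first exact: order_gt0.
  rewrite -{1}[w]fK -g1 -(expg_order (f w)).
  by elim: #[f w] => [|k IHk]; rewrite ?g1 // !expgS IHk gM.
- by rewrite -gM -morphM // yy /= gx.
- by rewrite -gM cc g1.
Qed.
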